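(* Let $x$ be an indeterminate. For every nonnegative integer $n$ the following identities hold in $\mathbb{Q}[x]$: $$x^{2n}+(x+1)^{2n}=\sum_{m=0}^n\left(\binom{2n-m}{m}+\binom{2n-m-1}{m-1}\right)x^m(x+1)^m$$ and $$x^{2n+1}+(x+1)^{2n+1}=\sum_{m=0}^n\binom{2n-m}{m}\left(x^{m+1}(x+1)^m+x^m(x+1)^{m+1}\right).$$
   Context: Binomial coefficients are defined, for a nonnegative integer $k$, by $\binom{a}{0}=1$ and $\binom{a}{k}=\frac{a(a-1)\cdots(a-k+1)}{k!}$. In addition, the following convention is used: if $a$ and $b$ are complex numbers such that $a-b$ is a nonnegative integer, then $\binom{a}{b}=\binom{a}{a-b}$. In particular $\binom{-1}{-1}=\binom{-1}{0}=1$, while $\binom{2n-1}{-1}=\binom{2n-1}{2n}=0$ for every integer $n\ge 1$. *)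

(* Defs.v *)
From mathcomp Require Import all_boot all_order all_algebra.

Set Implicit Arguments.
Unset Strict Implicit.
Unset Printing Implicit Defensive.

Import Order.TTheory GRing.Theory Num.Theory.
Local Open Scope ring_scope.

Definition fbinom (F : fieldType) (a : F) (k : nat) : F :=
  (\prod_(i < k) (a - i%:R)) / (k`!)%:R.

(* The value 0 when neither [b] nor [a - b] is a nonnegative integer is a
   placeholder for an undefined case. When both are, the two possible readings
   agree: see [gbinomE]. *)
Definition gbinom (F : archiNumFieldType) (a b : F) : F :=
  if b \is a Num.nat then fbinom a (Num.truncn b)
  else if a - b \is a Num.nat then fbinom a (Num.truncn (a - b))
  else 0.

Lemma fbinom_bin (F : numFieldType) (n k : nat) :
  fbinom (n%:R : F) k = 'C(n, k)%:R.
Proof.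
have prodE : \prod_(i < k) (n%:R - i%:R) = (n ^_ k)%:R :> F.
  elim: k => [|k IHk]; first by rewrite big_ord0 ffactn0.
  rewrite big_ord_recr /= IHk ffactnSr natrM.
  have [le_kn|lt_nk] := leqP k n; first by rewrite natrB.
  by rewrite ffact_small // !mul0r.
by rewrite /fbinom prodE -bin_ffact natrM mulfK // pnatr_eq0 -lt0n fact_gt0.
Qed.

Lemma gbinom_natr (F : archiNumFieldType) (a : F) (k : nat) :
  gbinom a k%:R = fbinom a k.
Proof. by rewrite /gbinom natr_nat natrK. Qed.

Lemma gbinomE (F : archiNumFieldType) (a b : F) (k : nat) :
  a - b = k%:R -> gbinom a b = fbinom a k.
Proof.
move=> abk; rewrite /gbinom abk natr_nat natrK; case: ifPn => // /natrP[m bm].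
have -> : a = (m + k)%:R by rewrite natrD -bm -abk addrC subrK.
by rewrite bm natrK !fbinom_bin -bin_sub ?leq_addr // addKn.
Qed.

(* Main.v *)
Require Import Defs.
From mathcomp Require Import all_boot all_order all_algebra.
From mathcomp Require Import zify ring.

Import Order.TTheory GRing.Theory Num.Theory.
Local Open Scope ring_scope.

(** Put [u := - x] and [v := x + 1], so that [u + v = 1] and [p := x (x + 1)]
    satisfies [u v = - p]: both are roots of [t ^ 2 = t + p]. The polynomials
    [F_k := \sum_m 'C(k - m, m) p ^ m] obey the Fibonacci recurrence
    [F_(k+2) = F_(k+1) + p F_k], hence the Binet formula
    [(v - u) F_k = v ^ (k+1) - u ^ (k+1)] and the Lucas formula
    [u ^ (k+2) + v ^ (k+2) = F_(k+2) + p F_k]. The two identities are the Lucas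
    and the Binet formula at even index. *)

Definition fib_poly (R : comNzRingType) (p : R) (k : nat) : R :=
  \sum_(0 <= m < k./2.+1) p ^+ m *+ 'C(k - m, m).

(** Past [k./2] one has [k - m < m], so the added binomials vanish; sums with different [k] can thus
    share a range. *)
Lemma fib_poly_widen (R : comNzRingType) (p : R) (k N : nat) :
  (k./2 < N)%N -> fib_poly R p k = \sum_(0 <= m < N) p ^+ m *+ 'C(k - m, m).
Proof.
move=> kN; rewrite (big_cat_nat (n := k./2.+1)) //= [X in _ + X]big_nat [X in _ + X]big1.
  by rewrite addr0.
by move=> m ?; rewrite bin_small ?mulr0n //; lia.
Qed.

(** Pascal's rule, coefficient by coefficient, once the [m = 0] term is split off and [m] is shifted
    by one. *)
Lemma fib_polyS (R : comNzRingType) (p : R) (k : nat) :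
  fib_poly R p k.+2 = fib_poly R p k.+1 + p * fib_poly R p k.
Proof.
rewrite (@fib_poly_widen _ _ k.+2 k.+2) ?(@fib_poly_widen _ _ k.+1 k.+2);
  [|lia..].
rewrite (@fib_poly_widen _ _ k k.+1); last lia.
rewrite big_nat_recl // [in RHS]big_nat_recl // !bin0 -addrA; congr (_ + _).
rewrite mulr_sumr -big_split; apply: eq_big_nat => j /andP[_ ltjk] /=.
by rewrite !subSS subSn // binS mulrnDr mulrnAr -exprS.
Qed.

Section RootsOfFibonacciEquation.

Variables (R : comNzRingType) (u v p : R).
Hypotheses (uDv : u + v = 1) (uMv : u * v = - p).

Let u_def : u = 1 - v. Proof. by rewrite -uDv addrK. Qed.
Let p_def : p = v ^+ 2 - v.
Proof. by apply: oppr_inj; rewrite -uMv u_def; ring. Qed.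

(** Both sides obey the same second-order recurrence in [k], hence an induction carrying two
    consecutive indices. The factor [v - u] is kept since [R] need not allow division. *)
Lemma fib_poly_Binet (k : nat) :
  (v - u) * fib_poly R p k = v ^+ k.+1 - u ^+ k.+1.
Proof.
suff: (v - u) * fib_poly R p k = v ^+ k.+1 - u ^+ k.+1 /\
      (v - u) * fib_poly R p k.+1 = v ^+ k.+2 - u ^+ k.+2 by case.
elim: k => [|k [IH0 IH1]].
  rewrite /fib_poly !big_nat1 !bin0 u_def; split; ring.
split=> //; rewrite fib_polyS mulrDr IH1 mulrCA IH0 p_def u_def !exprS; ring.
Qed.

Lemma fib_poly_Lucas (k : nat) :
  u ^+ k.+2 + v ^+ k.+2 = fib_poly R p k.+2 + p * fib_poly R p k.
Proof.
suff: u ^+ k.+2 + v ^+ k.+2 = fib_poly R p k.+2 + p * fib_poly R p k /\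
      u ^+ k.+3 + v ^+ k.+3 = fib_poly R p k.+3 + p * fib_poly R p k.+1
  by case.
elim: k => [|k [IH0 IH1]].
  rewrite !fib_polyS /fib_poly !big_nat1 !bin0 p_def u_def; split; ring.
split=> //; rewrite fib_polyS.
have -> : u ^+ k.+4 + v ^+ k.+4 =
    (u ^+ k.+3 + v ^+ k.+3) + p * (u ^+ k.+2 + v ^+ k.+2).
  rewrite p_def u_def !exprS; ring.
by rewrite IH0 IH1 (fib_polyS _ _ k); ring.
Qed.

End RootsOfFibonacciEquation.

Lemma gbinom_natrB (F : archiNumFieldType) (k m : nat) :
  (m <= k)%N -> gbinom (k%:R - m%:R : F) m%:R = 'C(k - m, m)%:R.
Proof. by move=> lemk; rewrite -natrB // gbinom_natr fbinom_bin. Qed.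

Theorem theorem2 (n : nat) :
  ('X ^+ (2 * n) + ('X + 1) ^+ (2 * n) =
     \sum_(0 <= m < n.+1)
       (gbinom ((2 * n)%:R - m%:R) m%:R
        + gbinom ((2 * n)%:R - m%:R - 1) (m%:R - 1))
       *: ('X ^+ m * ('X + 1) ^+ m) :> {poly rat})
  /\
  ('X ^+ (2 * n + 1) + ('X + 1) ^+ (2 * n + 1) =
     \sum_(0 <= m < n.+1)
       gbinom ((2 * n)%:R - m%:R) m%:R
       *: ('X ^+ (m + 1) * ('X + 1) ^+ m + 'X ^+ m * ('X + 1) ^+ (m + 1))
     :> {poly rat}).
Proof.
pose p : {poly rat} := 'X * ('X + 1).
have uDv : - 'X + ('X + 1) = 1 :> {poly rat} by rewrite addKr.
have uMv : - 'X * ('X + 1) = - p by rewrite mulNr.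
have fibE k : fib_poly _ p (2 * k) =
    \sum_(0 <= m < k.+1) p ^+ m *+ 'C(2 * k - m, m).
  by apply: fib_poly_widen; lia.
have evenN k : (- 'X) ^+ (2 * k) = 'X ^+ (2 * k) :> {poly rat}.
  by rewrite !exprM sqrrN.
split; last first.
  (* The odd power [2 * n + 1] turns the difference in the Binet formula into a sum, and
     [v - u = 'X + ('X + 1)] yields the two products in each term. *)
  transitivity (('X + 1 - - 'X) * fib_poly _ p (2 * n)).
    rewrite (fib_poly_Binet _ _ _ _ uDv uMv) addn1 [(- 'X) ^+ _]exprS evenN.
    by rewrite mulNr opprK -exprS addrC.
  rewrite fibE mulr_sumr; apply: eq_big_nat => m /andP[_ lemn].
  rewrite gbinom_natrB; last lia.
  by rewrite scaler_nat mulrnAr !addn1 !exprS exprMn; congr (_ *+ _); ring.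
(* The Lucas formula starts at exponent 2. For [n = 0] both binomials are 1, the second being -1
   over -1. *)
case: n => [|n].
  rewrite big_nat1 muln0 !subr0 !expr0 mulr1 sub0r.
  rewrite (@gbinom_natr _ _ 0) (@gbinomE _ _ _ 0) ?subrr //.
  by rewrite /fbinom !big_ord0 divr1 scalerDl scale1r.
transitivity (fib_poly _ p (2 * n.+1) + p * fib_poly _ p (2 * n)).
  rewrite -evenN; have -> : (2 * n.+1 = (2 * n).+2)%N by lia.
  exact: fib_poly_Lucas.
under eq_bigr do rewrite scalerDl -exprMn -/p.
rewrite big_split /=; congr (_ + _).
  rewrite fibE; apply: eq_big_nat => m /andP[_ lemn].
  by rewrite gbinom_natrB ?scaler_nat //; lia.
(* At [m = 0] the lower index is -1, so the symmetry convention applies: the value is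
   ['C(2 * n + 1, 2 * n + 2) = 0]. Shifting [m] in the remaining terms gives
   [p * fib_poly _ p (2 * n)]. *)
rewrite big_nat_recl // subr0 (@gbinomE _ _ _ (2 * n.+1)); last by ring.
have -> : (2 * n.+1)%:R - 1 = (2 * n).+1%:R :> rat.
  by rewrite mulnS !add2n -natr1 addrK.
rewrite fbinom_bin bin_small; last lia.
rewrite scale0r add0r fibE mulr_sumr; apply: eq_big_nat => m /andP[_ lemn].
have -> : (2 * n.+1)%:R - m.+1%:R - 1 = (2 * n)%:R - m%:R :> rat by ring.
rewrite -natr1 addrK gbinom_natrB; last lia.
by rewrite scaler_nat mulrnAr -exprS.
Qed.
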